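(* Let $L$ be a finite distributive lattice, let $J(L)$ be its poset of join-irreducible elements, and fix a partition of $J(L)$ into $n$ chains $C_1,\dots,C_n$. For $G\in L$ and $1\le r\le n$, let $G[r]$ denote the number of elements of $C_r$ that lie in the order ideal of $J(L)$ corresponding to $G$. Let $B$ be a regular boolean predicate on $L$. Let $M=\{M_1,\dots,M_k\}\subseteq L$ be a set of $k$ elements, each of which satisfies $B$. For each $j$ with $1\le j\le k$, let $G^j$ be the element of $L$ determined by the requirement that, for every $r\in\{1,\dots,n\}$, $G^j[r]$ is the $j$-th element of the multiset $\{M_i[r] : 1\le i\le k\}$ sorted in nondecreasing order. Then $G^j$ satisfies $B$.
   Context: By Birkhoff's representation theorem, the map sending $G\in L$ to the order ideal $\{x\in J(L): x\le G\}$ of $J(L)$ is a bijection between $L$ and the order ideals (down-closed subsets) of $J(L)$; this is the order ideal ''corresponding to $G$''. A boolean predicate $B$ on $L$ is called regular if the set of elements of $L$ satisfying $B$ is a sublattice of $L$, i.e., whenever $G$ and $H$ satisfy $B$, so do $G\sqcup H$ and $G\sqcap H$ (join and meet in $L$). *)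

(* Defs.v *)
From mathcomp Require Import all_boot all_order.

Set Implicit Arguments.
Unset Strict Implicit.
Unset Printing Implicit Defensive.

Import Order.TTheory.
Local Open Scope order_scope.

Section Definitions.
Variables (d : Order.disp_t) (L : finTBDistrLatticeType d).
Implicit Types (x G H : L) (B : pred L).

Definition join_irreducible x : bool :=
  (x != \bot) &&
  [forall G, forall H, (x == G `|` H) ==> (x == G) || (x == H)].

(* The underlying set of J(L); its order is the restriction of that of L. *)
Definition Jset : {set L} := [set x | join_irreducible x].

Definition order_ideal G : {set L} := [set x in Jset | x <= G].

Definition is_chain (A : {set L}) : Prop := {in A &, total <=%O}.

(* Injectivity makes the n classes distinct, so that C is an indexing of the
   blocks of the partition; [partition] makes them nonempty. *)
Definition chain_partition n (C : 'I_n -> {set L}) : Prop :=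
  [/\ injective C,
      partition [set C r | r : 'I_n] Jset
    & forall r, is_chain (C r)].

(* G[r] *)
Definition chain_count n (C : 'I_n -> {set L}) G (r : 'I_n) : nat :=
  #|C r :&: order_ideal G|.

Definition regular B : Prop :=
  forall G H, B G -> B H -> B (G `|` H) /\ B (G `&` H).

(* G is a G^j, with 1 <= j <= k as in the text, hence the index j.-1. *)
Definition is_jth_element n (C : 'I_n -> {set L}) k (M : 'I_k -> L)
    (j : nat) G : Prop :=
  forall r : 'I_n,
    chain_count C G r =
    nth 0%N (sort leq [seq chain_count C (M i) r | i <- enum 'I_k]) j.-1.

End Definitions.

(* Main.v *)
Require Import Defs.
From mathcomp Require Import all_boot all_order.
From mathcomp Require Import zify.

(** With m = k - j + 1, the witness is G = \join_(#|A| >= m) \meet_(i in A) M_i,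
    which satisfies B because these joins and meets are nonempty.
    Join-irreducibles being join-prime in a distributive lattice, x <= G holds
    iff x <= M_i for at least m indices i.  On a chain C_r the traces of the
    ideals of the M_i are nested, so the trace of the ideal of G is that of any
    M_i whose count is the j-th smallest.  Nestedness also shows that the counts
    determine the ideal, hence the element. *)

Set Implicit Arguments.
Unset Strict Implicit.
Unset Printing Implicit Defensive.

Import Order.TTheory.
Local Open Scope order_scope.

(** The unit [idx] (later [\bot] or [\top]) need not satisfy [B], so [i0] witnesses that the range
    is nonempty. *)
Lemma big_closed_nonempty (T : Type) (idx : T) (op : Monoid.com_law idx)
    (B : pred T) (I : finType) (P : pred I) (F : I -> T) (i0 : I) :
    (forall x y, B x -> B y -> B (op x y)) ->
    (forall i, P i -> B (F i)) -> P i0 ->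
  B (\big[op/idx]_(i | P i) F i).
Proof.
move=> Bop BF Pi0; rewrite (bigD1 i0) //=.
(* The invariant is [B (op (F i0) y)], since the partial result [y] alone may be the unit. *)
elim/big_rec: _ => [|i y /andP[Pi _] By]; first by rewrite Monoid.mulm1 BF.
by rewrite Monoid.mulmCA Bop // BF.
Qed.

Section SortedCount.
Local Open Scope nat_scope.
Variables (s : seq nat) (i : nat).
Hypotheses (s_sorted : sorted leq s) (lt_i_s : i < size s).

(** All entries from position [i] on qualify; ties may add earlier ones, hence only an
    inequality. *)
Lemma sorted_count_ge_nth :
  size s - i <= count (fun y => nth 0 s i <= y) s.
Proof.
rewrite -[X in count _ X](cat_take_drop i) count_cat -size_drop.
suff /eqP-> : count (fun y => nth 0 s i <= y) (drop i s) == size (drop i s).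
  exact: leq_addl.
rewrite -all_count; apply/(all_nthP 0) => l; rewrite size_drop nth_drop => lt_l.
by apply: (sorted_leq_nth leq_trans leqnn); rewrite ?inE //; lia.
Qed.

Lemma sorted_count_le_nth :
  i < count (fun y => y <= nth 0 s i) s.
Proof.
rewrite -[X in count _ X](cat_take_drop i.+1) count_cat.
have sz : size (take i.+1 s) = i.+1 by rewrite size_takel.
suff /eqP-> : count (fun y => y <= nth 0 s i) (take i.+1 s)
    == size (take i.+1 s) by rewrite sz leq_addr.
rewrite -all_count; apply/(all_nthP 0) => l; rewrite sz => lt_l.
rewrite nth_take //.
by apply: (sorted_leq_nth leq_trans leqnn); rewrite ?inE //; lia.
Qed.

End SortedCount.

(** Sorting only permutes the list, so the two bounds above become bounds on numbers of indices. *)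
Lemma count_sort_enum (k : nat) (c : 'I_k -> nat) (p : pred nat) :
  count p (sort leq [seq c i | i <- enum 'I_k]) = #|[set i | p (c i)]|.
Proof.
rewrite (permP (permEl (perm_sort _ _))) count_map cardsE cardE.
by rewrite -size_filter enumT.
Qed.

Section Birkhoff.
Variables (d : Order.disp_t) (L : finTBDistrLatticeType d).
Implicit Types (x y G H : L).

(** By distributivity, an [x] below the join is the join of its meets with [G] and [H];
    irreducibility makes it equal to one of them. *)
Lemma join_irreducible_leU x G H :
  join_irreducible x -> (x <= G `|` H) = (x <= G) || (x <= H).
Proof.
case/andP=> _ /forallP/(_ (x `&` G))/forallP/(_ (x `&` H)) irr_x.
apply/idP/orP => [le_x|[] le_x]; last 2 first.
- exact: le_trans le_x (leUl _ _).
- exact: le_trans le_x (leUr _ _).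
move: irr_x; rewrite -meetUr (meet_l le_x) eqxx /= => /orP[] /eqP xE.
- by left; rewrite leEmeet -xE.
- by right; rewrite leEmeet -xE.
Qed.

Lemma join_irreducible_le_joins (I : finType) (P : pred I) (F : I -> L) x :
  join_irreducible x ->
  reflect (exists2 i, P i & x <= F i) (x <= \join_(i | P i) F i).
Proof.
move=> irr_x; apply: (iffP idP) => [|[i Pi le_x]].
  elim/big_rec: _ => [|i y Pi IH].
    by rewrite lex0 => /eqP x0; move: irr_x; rewrite /join_irreducible x0 eqxx.
  by rewrite join_irreducible_leU // => /orP[|/IH//]; exists i.
exact: le_trans le_x (joins_sup _ Pi).
Qed.

Lemma in_order_ideal x G : x \in Jset L -> (x \in order_ideal G) = (x <= G).
Proof. by move=> Jx; rewrite inE Jx. Qed.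

(** Strong induction on the number of elements strictly below [G]: a join-irreducible [G] lies in
    its own ideal, and any other [G] except [\bot] is a join of two strictly smaller elements. *)
Lemma order_ideal_sub_le G H : order_ideal G \subset order_ideal H -> G <= H.
Proof.
have [m] := ubnP #|[set y | y < G]|.
elim: m G => // m IH G /ltnSE le_m /subsetP sGH.
have IHlt G' : G' < G -> G' <= H.
  move=> lt_G'; apply: IH.
    apply: leq_trans le_m; apply: proper_card; apply/properP; split.
      by apply/subsetP=> y; rewrite !inE => /lt_trans; apply.
    by exists G'; rewrite !inE ?ltxx.
  apply/subsetP=> x; rewrite inE => /andP[Jx le_x]; apply: sGH.
  by rewrite in_order_ideal // (le_trans le_x (ltW lt_G')).
have [->|nz_G] := eqVneq G \bot; first exact: le0x.
have [irr_G|] := boolP (join_irreducible G).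
  have JG : G \in Jset L by rewrite inE.
  by rewrite -in_order_ideal // sGH // in_order_ideal.
rewrite /join_irreducible nz_G /= => /forallPn[X /forallPn[Y]].
rewrite negb_imply negb_or => /and3P[/eqP GE neX neY].
rewrite GE leUx !IHlt //.
- by rewrite lt_neqAle eq_sym neY GE leUr.
- by rewrite lt_neqAle eq_sym neX GE leUl.
Qed.

(** If [x] is in the first trace only, each [y] in the second is comparable with [x], and [x <= y]
    would give [x <= H]; so [y <= x <= G]. *)
Lemma chain_ideal_total (A : {set L}) G H : is_chain A ->
  (A :&: order_ideal G \subset A :&: order_ideal H)
  || (A :&: order_ideal H \subset A :&: order_ideal G).
Proof.
move=> chA; apply/orP.
have [sGH|/subsetPn[x]] :=
  boolP (A :&: order_ideal G \subset A :&: order_ideal H); first by left.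
rewrite !inE => /andP[Ax /andP[Jx xG]]; rewrite Ax Jx /= => nxH; right.
apply/subsetP=> y; rewrite !inE => /andP[Ay /andP[Jy yH]]; rewrite Ay Jy /=.
have /orP[xy|yx] := chA _ _ Ax Ay; last exact: le_trans yx xG.
by rewrite (le_trans xy yH) in nxH.
Qed.

(** Were the inclusion the reverse one, the cardinalities would force equality. *)
Lemma chain_ideal_subset (A : {set L}) G H : is_chain A ->
  (#|A :&: order_ideal G| <= #|A :&: order_ideal H|)%N ->
  A :&: order_ideal G \subset A :&: order_ideal H.
Proof.
move=> chA le_GH; have /orP[//|sHG] := chain_ideal_total G H chA.
by have /eqP-> : A :&: order_ideal H == A :&: order_ideal G
  by rewrite eqEcard sHG.
Qed.

Section Chains.
Variables (n : nat) (C : 'I_n -> {set L}).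
Hypothesis hC : chain_partition C.

Lemma chain_subset_Jset r : C r \subset Jset L.
Proof.
have [_ /and3P[/eqP<- _ _] _] := hC.
by apply: bigcup_sup; apply: imset_f.
Qed.

Lemma mem_chain x : x \in Jset L -> exists r, x \in C r.
Proof.
have [_ /and3P[/eqP<- _ _] _] := hC.
by move=> /bigcupP[_ /imsetP[r _ ->] xC]; exists r.
Qed.

Lemma chain_count_inj G H : chain_count C G =1 chain_count C H -> G = H.
Proof.
move=> eqGH; have [_ _ chC] := hC.
have sub X Y : chain_count C X =1 chain_count C Y -> X <= Y.
  move=> eqXY; apply: order_ideal_sub_le; apply/subsetP=> x xX.
  have Jx : x \in Jset L by move: xX; rewrite inE => /andP[].
  have [r xr] := mem_chain Jx.
  have /subsetP/(_ x) :
      C r :&: order_ideal X \subset C r :&: order_ideal Y.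
    apply: chain_ideal_subset => //.
    by rewrite -!/(chain_count _ _ _) eqXY.
  by rewrite !in_setI xr xX => /(_ isT).
by apply/le_anti; rewrite !sub // => r.
Qed.

Variables (k : nat) (M : 'I_k -> L).

(** With [<=] rather than equality, the set of all [i] with [x <= M i] can itself serve as [A] once
    it is large enough. *)
Definition threshold (m : nat) : L :=
  \join_(A : {set 'I_k} | (m <= #|A|)%N) \meet_(i in A) M i.

(** [0 < m] keeps every meet nonempty, and [m <= k] makes [setT] an admissible index of the join. *)
Lemma threshold_regular (B : pred L) (m : nat) : regular B ->
  (forall i, B (M i)) -> (0 < m <= k)%N -> B (threshold m).
Proof.
move=> hB BM /andP[m_gt0 le_mk]; apply: (@big_closed_nonempty _ _ _ _ _ _ _ setT).
- by move=> G H BG BH; case: (hB G H BG BH).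
- move=> A le_mA; have /card_gt0P[i0 Ai0] : (0 < #|A|)%N := leq_trans m_gt0 le_mA.
  apply: (@big_closed_nonempty _ _ _ _ _ _ _ i0) => // G H BG BH.
  by case: (hB G H BG BH).
- by rewrite cardsT card_ord.
Qed.

Lemma le_threshold (m : nat) x : x \in Jset L ->
  (x <= threshold m) = (m <= #|[set i | (x <= M i)%O]|)%N.
Proof.
rewrite inE => irr_x; apply/join_irreducible_le_joins/idP => // [[A le_mA leA]|].
  apply: leq_trans le_mA _; apply: subset_leq_card; apply/subsetP=> i Ai.
  by rewrite inE (le_trans leA) // meets_inf.
move=> le_m; exists [set i | x <= M i] => //.
by apply/meetsP=> i; rewrite inE.
Qed.

Lemma threshold_is_jth_element (j : nat) : (1 <= j <= k)%N ->
  is_jth_element C M j (threshold (k - j.-1)).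
Proof.
move=> hj r; set c := fun i => chain_count C (M i) r.
set s := sort leq _; set v := nth _ _ _.
have sz_s : size s = k by rewrite size_sort size_map size_enum_ord.
have lt_js : (j.-1 < size s)%N by lia.
have s_sorted : sorted leq s by apply: sort_sorted; apply: leq_total.
(* Since [v] is attained by some [M i0], it suffices that the threshold element and [M i0] have the
   same trace on [C r]. *)
have [i0 vE] : exists i0, v = c i0.
  have : v \in s by apply: mem_nth.
  by rewrite mem_sort => /mapP[i0 _ ->]; exists i0.
have ge_v := sorted_count_ge_nth s_sorted lt_js.
have le_v := sorted_count_le_nth s_sorted lt_js.
rewrite -/v /s (count_sort_enum c) sz_s in ge_v.
rewrite -/v /s (count_sort_enum c) in le_v.
have [_ _ chC] := hC; have CJ := chain_subset_Jset r.
rewrite vE; congr #|pred_of_set _|; apply/setP=> x; rewrite !in_setI.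
case Cx : (x \in C r) => //=; have Jx := subsetP CJ _ Cx.
have le_subset i i' : (c i <= c i')%N -> x <= M i -> x <= M i'.
  move=> le_c le_x; have /subsetP/(_ x) := chain_ideal_subset (chC r) le_c.
  by rewrite !in_setI Cx !in_order_ideal // => /(_ le_x).
rewrite !in_order_ideal // le_threshold //.
apply/idP/idP => [le_m|le_x].
  (* At least [j] indices have count at most [v]. If [x] is not below [M i0], it is below none of
     these [M i], which leaves at most [k - j] indices. *)
  apply: contraLR le_m => nle_x; rewrite -ltnNge.
  have sub : [set i | x <= M i] \subset ~: [set i | (c i <= v)%N].
    apply/subsetP=> i; rewrite !inE vE => le_x.
    by apply: contra nle_x => /le_subset; apply.
  apply: leq_ltn_trans (subset_leq_card sub) _.
  by rewrite cardsCs setCK card_ord ltn_sub2l //; lia.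
(* Conversely, at least [k - j.-1] indices have count at least [v], and [x <= M i] for each of
   them. *)
apply: leq_trans ge_v _; apply: subset_leq_card; apply/subsetP=> i.
by rewrite !inE vE => /le_subset; apply.
Qed.

End Chains.
End Birkhoff.

Theorem theorem2 (d : Order.disp_t) (L : finTBDistrLatticeType d)
    (n : nat) (C : 'I_n -> {set L}) (hC : chain_partition C)
    (B : pred L) (hB : regular B)
    (k : nat) (M : 'I_k -> L) (injM : injective M)
    (hM : forall i : 'I_k, B (M i))
    (j : nat) (hj : (1 <= j <= k)%N) :
  (exists! G : L, is_jth_element C M j G) /\
  (forall G : L, is_jth_element C M j G -> B G).
Proof.
have jth := threshold_is_jth_element hC M hj.
have uniq_jth G : is_jth_element C M j G -> threshold M (k - j.-1) = G.
  by move=> jthG; apply: (chain_count_inj hC) => r; rewrite jth jthG.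
split; first by exists (threshold M (k - j.-1)).
by move=> G /uniq_jth <-; apply: threshold_regular => //; lia.
Qed.
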